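(* There is an algorithm that, given an interval biclique partition $(\mathcal B,\prec)$ of an $n$-vertex graph $G$ and a column vector $X\in\mathcal A^n$ over an additive (abelian) group $\mathcal A$, computes $\mathrm{adj}_\prec(G)X$ in time $O(n+|\mathcal B|)$.
   Context: An interval biclique partition $(\mathcal B,\prec)$ of $G$ consists of a linear order $\prec$ on $V(G)$, identified with $[n]$ in its natural order, and a partition $\mathcal B$ of $E(G)$ into bicliques $\{xy:x\in[a_1,a_2],y\in[b_1,b_2]\}$ with $[a_1,a_2],[b_1,b_2]$ disjoint intervals; each biclique is given as the tuple $(a_1,a_2,b_1,b_2)$. $\mathrm{adj}_\prec(G)$ is the adjacency matrix of $G$ with rows and columns ordered by $\prec$; for $X\in\mathcal A^n$, $(\mathrm{adj}_\prec(G)X)[i]=\sum_{j: ij\in E(G)}X[j]$. *)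

(* Defs.v *)
From mathcomp Require Import all_boot all_order all_algebra.

Set Implicit Arguments.
Unset Strict Implicit.
Unset Printing Implicit Defensive.

Import Order.TTheory GRing.Theory.

Record sgraph (V : finType) := SGraph {
  edge :> rel V;
  edge_sym : symmetric edge;
  edge_irr : irreflexive edge
}.

Definition edge_set (V : finType) (G : sgraph V) : {set {set V}} :=
  [set [set p.1; p.2] | p in [set p : V * V | G p.1 p.2]].

(** The linear order on the vertices is the order of [V : finOrderType d]; the
    identification of [V] with [n] (0-based: {0, .., n - 1}, n = #|V|) is the
    pair of monotone bijections [Order.enum_rank] and [Order.enum_val]. *)

Section IntervalBicliques.
Variables (d : Order.disp_t) (V : finOrderType d).

Definition itv (a b : V) : {set V} := [set x | (a <= x <= b)%O].

Record biclique := Biclique { a1 : V; a2 : V; b1 : V; b2 : V }.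

Definition biclique_ok (b : biclique) : bool :=
  [&& (a1 b <= a2 b)%O, (b1 b <= b2 b)%O
    & [disjoint itv (a1 b) (a2 b) & itv (b1 b) (b2 b)]].

Definition biclique_edges (b : biclique) : {set {set V}} :=
  [set [set x; y] | x in itv (a1 b) (a2 b), y in itv (b1 b) (b2 b)].

(** [B] lists the blocks of the partition in an arbitrary order and without
    repetition, so that [size B] is the number of blocks. *)
Definition interval_biclique_partition (G : sgraph V) (B : seq biclique) : Prop :=
  [/\ all biclique_ok B,
      uniq [seq biclique_edges b | b <- B]
    & partition [set:: [seq biclique_edges b | b <- B]] (edge_set G)].

Definition adj_mx (G : sgraph V) : 'M[bool]_#|V| :=
  \matrix_(i, j) G (Order.enum_val i) (Order.enum_val j).

Definition adj_mul (A : zmodType) (G : sgraph V) (X : 'cV[A]_#|V|) :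
    'cV[A]_#|V| :=
  (\col_i \sum_(j | adj_mx G i j) X j 0)%R.

Definition biclique_words (b : biclique) : seq nat :=
  [seq nat_of_ord (Order.enum_rank x) | x <- [:: a1 b; a2 b; b1 b; b2 b]].

End IntervalBicliques.

(** Computation model: a word RAM extended with registers and a memory holding
    elements of an abelian group, which the machine can only copy, add and
    subtract.  Every instruction takes one unit of time.  Programs mention
    neither the group nor the input. *)

Inductive instr :=
| WConst of nat & nat         (* r := k *)
| WAdd of nat & nat & nat     (* r := s + t *)
| WSub of nat & nat & nat     (* r := s - t, truncated at 0 *)
| WLoad of nat & nat          (* r := wmem[s] *)
| WStore of nat & nat         (* wmem[s] := r, for [WStore s r] *)
| GAdd of nat & nat & nat     (* g := h + k, in the group *)
| GSub of nat & nat & nat     (* g := h - k, in the group *)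
| GLoad of nat & nat          (* g := gmem[s], s a word register *)
| GStore of nat & nat         (* gmem[s] := g, for [GStore s g] *)
| Jump of nat                 (* goto l *)
| JumpLt of nat & nat & nat.  (* if r < s then goto l *)

Definition program := seq instr.

Record state (A : Type) := State {
  pc : nat;
  wreg : nat -> nat;
  greg : nat -> A;
  wmem : nat -> nat;
  gmem : nat -> A
}.

Definition upd (T : Type) (f : nat -> T) (k : nat) (v : T) : nat -> T :=
  fun i => if i == k then v else f i.

Section Machine.
Variable A : zmodType.

(** Words are the naturals below [W]: the machine is stuck ([None]) when it
    would put a larger number in a register.  Since addresses come from
    registers, only the first [W] cells of each memory can be accessed. *)
Definition set_word (W : nat) (s : state A) (r v : nat) : option (state A) :=
  if v < W then
    Some (State (pc s).+1 (upd (wreg s) r v) (greg s) (wmem s) (gmem s))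
  else None.

Definition set_group (s : state A) (g : nat) (v : A) : option (state A) :=
  Some (State (pc s).+1 (wreg s) (upd (greg s) g v) (wmem s) (gmem s)).

Definition goto (s : state A) (l : nat) : option (state A) :=
  Some (State l (wreg s) (greg s) (wmem s) (gmem s)).

Definition step (W : nat) (i : instr) (s : state A) : option (state A) :=
  match i with
  | WConst r k => set_word W s r k
  | WAdd r x y => set_word W s r (wreg s x + wreg s y)
  | WSub r x y => set_word W s r (wreg s x - wreg s y)
  | WLoad r x => set_word W s r (wmem s (wreg s x))
  | WStore x r => Some (State (pc s).+1 (wreg s) (greg s)
                         (upd (wmem s) (wreg s x) (wreg s r)) (gmem s))
  | GAdd g h k => set_group s g (greg s h + greg s k)%R
  | GSub g h k => set_group s g (greg s h - greg s k)%R
  | GLoad g x => set_group s g (gmem s (wreg s x))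
  | GStore x g => Some (State (pc s).+1 (wreg s) (greg s) (wmem s)
                          (upd (gmem s) (wreg s x) (greg s g)))
  | Jump l => goto s l
  | JumpLt x y l => goto s (if wreg s x < wreg s y then l else (pc s).+1)
  end.

(** [exec W P t s] is [Some s'] when [P], started in [s], halts in [s'] after at
    most [t] steps; it is [None] if [P] gets stuck or needs more time.  A program
    halts when its program counter leaves it. *)
Fixpoint exec (W : nat) (P : program) (t : nat) (s : state A) :
    option (state A) :=
  match onth P (pc s), t with
  | None, _ => Some s
  | Some _, 0 => None
  | Some i, t'.+1 => obind (exec W P t') (step W i s)
  end.

Definition init (ws : seq nat) (gs : seq A) : state A :=
  State 0 (fun=> 0) (fun=> 0%R) (nth 0 ws) (nth 0%R gs).

End Machine.

(** The words of the input are n, |B| and then the four endpoints of each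
    biclique; the group elements are the entries of X. *)
Definition input (d : Order.disp_t) (V : finOrderType d) (A : zmodType)
    (B : seq (biclique V)) (X : 'cV[A]_#|V|) : state A :=
  init [:: #|V|, size B & flatten [seq biclique_words b | b <- B]]
       [seq X i 0%R | i <- enum 'I_#|V|].

(* Main.v *)
Require Import Defs.
From mathcomp Require Import all_boot all_order all_algebra.
From mathcomp Require Import zify.

(** The sum of X over an interval is a difference of two of its prefix sums, and
    adding a constant to an interval of the output costs two point updates of
    its difference array.  So after one pass over X each biclique is handled
    in constant time, and a last pass of prefix sums over the difference array
    produces the output.  This counts each edge once, because the bicliques
    partition the edges and the two sides of a biclique are disjoint. *)

Set Implicit Arguments.
Unset Strict Implicit.
Unset Printing Implicit Defensive.

Import Order.TTheory GRing.Theory.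

(** * Runs of the machine: composition, loops, and the program *)

Section Reaches.
Variables (A : zmodType) (W : nat) (P : program).

(** Quantifying over the leftover fuel [t'] makes exact step counts add up under composition. *)
Definition reaches (t : nat) (s s' : state A) : Prop :=
  forall t', exec W P (t + t') s = exec W P t' s'.

Lemma reaches0 s : reaches 0 s s.
Proof. by []. Qed.

Lemma reaches_trans t1 t2 s1 s2 s3 :
  reaches t1 s1 s2 -> reaches t2 s2 s3 -> reaches (t1 + t2) s1 s3.
Proof. by move=> h1 h2 t'; rewrite -addnA h1 h2. Qed.

Lemma reaches_step i t s s1 s2 :
  onth P (pc s) = Some i -> step W i s = Some s1 -> reaches t s1 s2 ->
  reaches t.+1 s s2.
Proof. by move=> hi hs h t'; rewrite addSn /= hi hs /= h. Qed.

Lemma exec_halted t (s : state A) :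
  onth P (pc s) = None -> exec W P t s = Some s.
Proof. by case: t => [|t] /= ->. Qed.

Lemma reaches_exec t T s s' :
  reaches t s s' -> onth P (pc s') = None -> t <= T -> exec W P T s = Some s'.
Proof. by move=> h hs' /subnKC <-; rewrite h exec_halted. Qed.

(** In its uses [Inv k] describes the loop head after [k] iterations, so [t] includes the successful
    test; the failing test is counted after the loop. *)
Lemma reaches_loop (Inv : nat -> state A -> Prop) (K t : nat) :
  (forall k s, k < K -> Inv k s -> exists2 s', reaches t s s' & Inv k.+1 s') ->
  forall s, Inv 0 s -> exists2 s', reaches (K * t) s s' & Inv K s'.
Proof.
elim: K => [|K IH] body s inv0; first by exists s.
have [k s' kK|s1 r1 inv1] := IH _ s inv0; first exact/body/ltnW.
have [s2 r2 inv2] := body K s1 (ltnSn K) inv1.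
by exists s2; rewrite ?mulSnr //; apply: reaches_trans r1 r2.
Qed.

End Reaches.

(* Word registers: r1 = n, r2 = 1, r3 = |B|, r4 = loop counter.  The group
   memory holds X at 0 .. n - 1, its prefix sums at n .. 2n, and the difference
   array at 2n + 1 .. 3n + 1; the last two regions are initially zero. *)
Definition biclique_program : program :=
  [:: WConst 2 1; WLoad 1 0; WLoad 3 2; WAdd 5 1 2;
      (* address 4; at the exit r5 = 2n + 1, the base of the difference array *)
      JumpLt 4 1 6; Jump 12;
      GLoad 1 4; GAdd 0 0 1; GStore 5 0; WAdd 4 4 2; WAdd 5 5 2; Jump 4;
      WConst 6 2; WConst 4 0;
      (* address 14; r6 points into the input words *)
      JumpLt 4 3 16; Jump 54;
      WLoad 7 6; WAdd 6 6 2;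
      WLoad 8 6; WAdd 6 6 2; WAdd 8 8 2;
      WLoad 9 6; WAdd 6 6 2;
      WLoad 10 6; WAdd 6 6 2; WAdd 10 10 2;
      WAdd 11 1 8; GLoad 1 11; WAdd 11 1 7; GLoad 2 11; GSub 1 1 2;
      WAdd 11 1 10; GLoad 2 11; WAdd 11 1 9; GLoad 3 11; GSub 2 2 3;
      WAdd 11 5 7; GLoad 3 11; GAdd 3 3 2; GStore 11 3;
      WAdd 11 5 8; GLoad 3 11; GSub 3 3 2; GStore 11 3;
      WAdd 11 5 9; GLoad 3 11; GAdd 3 3 1; GStore 11 3;
      WAdd 11 5 10; GLoad 3 11; GSub 3 3 1; GStore 11 3;
      WAdd 4 4 2; Jump 14;
      WConst 4 0; GSub 0 0 0;
      (* address 56; r5 points into the difference array *)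
      JumpLt 4 1 58; Jump 64;
      GLoad 1 5; GAdd 0 0 1; GStore 4 0; WAdd 4 4 2; WAdd 5 5 2; Jump 56].

(* Only concrete register numbers are resolved: for a symbolic address the test
   [eqn i k] does not reduce to a boolean and the update is left alone. *)
Ltac lookup := repeat match goal with
  |- context [@upd ?T ?f ?k ?v ?i] =>
    let b := eval cbv in (eqn i k) in
    match b with
    | true => change (@upd T f k v i) with v
    | false => change (@upd T f k v i) with (f i)
    end
  end.

(** Symbolic execution of one instruction: [e] collects known values, and [lia] settles the word
    bound or the branch condition. *)
Ltac tick e := eapply reaches_step;
  [ reflexivity
  | rewrite /step /set_word /set_group /goto; cbn [pc wreg greg wmem gmem];
    lookup; rewrite ?e;
    first [rewrite ifT; [reflexivity | lia] | rewrite ifN; [reflexivity | lia]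
          | reflexivity]
  | cbn [pc wreg greg wmem gmem]].

(** * Correctness of the program, one invariant per loop *)

Section Correctness.
Local Open Scope ring_scope.
Variables (A : zmodType) (W n m : nat) (wm : nat -> nat) (x : nat -> A).
Variables (p1 p2 q1 q2 : nat -> nat).

Hypothesis W_gt_n : (3 * n + 3 < W)%N.
Hypothesis W_gt_m : (4 * m + 3 < W)%N.
Hypothesis wm0 : wm 0 = n.
Hypothesis wm1 : wm 1 = m.
Hypothesis wmB : forall k, (k < m)%N ->
  [/\ wm (2 + 4 * k) = p1 k, wm (3 + 4 * k) = p2 k,
      wm (4 + 4 * k) = q1 k & wm (5 + 4 * k) = q2 k].
Hypothesis ltB : forall k, (k < m)%N ->
  [/\ p1 k < n, p2 k < n, q1 k < n & q2 k < n]%N.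
Hypothesis x_out : forall i, (n <= i)%N -> x i = 0.

Local Notation reaches := (@reaches A W biclique_program).

Definition psum (k : nat) : A := \sum_(0 <= j < k) x j.

Definition delta (a : nat) (v : A) (j : nat) : A := if j == a then v else 0.

(** A cell that is read, changed and written back gains a point mass, so successive updates
    accumulate even when their addresses coincide. *)
Lemma upd_delta (f : nat -> A) (a : nat) (v : A) (j : nat) :
  upd f a (f a + v) j = f j + delta a v j.
Proof. by rewrite /upd /delta; case: eqP => [->|_] //; rewrite addr0. Qed.

Lemma delta_shift (o a j : nat) (v : A) :
  delta (o + a) v (o + j) = delta a v j.
Proof. by rewrite /delta eqn_add2l. Qed.

Lemma deltaN (a j : nat) (v : A) : delta a (- v) j = - delta a v j.
Proof. by rewrite /delta; case: ifP; rewrite ?oppr0. Qed.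

Lemma sum_delta (a i : nat) (v : A) :
  \sum_(0 <= j < i.+1) delta a v j = if (a <= i)%N then v else 0.
Proof. by rewrite -big_mkcond big_nat1_eq. Qed.

Lemma delta_itv (a c i : nat) (v : A) : (a <= c)%N ->
  (if (a <= i)%N then v else 0) - (if (c < i)%N then v else 0) =
  if (a <= i <= c)%N then v else 0.
Proof.
move=> ac; case: (ltnP c i) => ci; last by rewrite andbT subr0.
by rewrite (leq_trans ac (ltnW ci)) subrr.
Qed.

(** Difference array of the contribution of one biclique: each vertex of a side gains the sum of X
    over the other side. Intervals are closed, hence the successors. *)
Definition biclique_diff (k j : nat) : A :=
  let sp := psum (p2 k).+1 - psum (p1 k) in
  let sq := psum (q2 k).+1 - psum (q1 k) in
  delta (p1 k) sq j - delta (p2 k).+1 sq j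
  + (delta (q1 k) sp j - delta (q2 k).+1 sp j).

Definition diff (k j : nat) : A := \sum_(0 <= l < k) biclique_diff l j.

Definition prefix_inv (k : nat) (s : state A) : Prop :=
  [/\ pc s = 4%N, [/\ wreg s 1 = n, wreg s 2 = 1%N, wreg s 3 = m, wreg s 4 = k
      & wreg s 5 = (n.+1 + k)%N], greg s 0 = psum k, wmem s = wm
    & forall j, gmem s j = if (j < n)%N then x j else
                           if (j <= n + k)%N then psum (j - n) else 0].

Definition biclique_inv (k : nat) (s : state A) : Prop :=
  [/\ pc s = 14%N, [/\ wreg s 1 = n, wreg s 2 = 1%N, wreg s 3 = m, wreg s 4 = k
      & wreg s 5 = (n + n).+1 /\ wreg s 6 = (2 + 4 * k)%N], wmem s = wm,
      forall j, (j <= n)%N -> gmem s (n + j) = psum j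
    & forall j, gmem s ((n + n).+1 + j) = diff k j].

(** The output overwrites the cells of X, all below the base [(n + n).+1], so the difference array
    stays intact while it is read. *)
Definition output_inv (k : nat) (s : state A) : Prop :=
  [/\ pc s = 56%N, [/\ wreg s 1 = n, wreg s 2 = 1%N, wreg s 4 = k
      & wreg s 5 = ((n + n).+1 + k)%N],
      greg s 0 = \sum_(0 <= j < k) diff m j,
      forall j, (j < k)%N -> gmem s j = \sum_(0 <= l < j.+1) diff m l
    & forall j, gmem s ((n + n).+1 + j) = diff m j].

(** Cell [n] is never written: its initial zero, given by [x_out], already is [psum 0]. This is why
    [r5] starts at [n.+1]. *)
Lemma init_prefix_inv g :
  g 0 = 0 -> exists2 s', reaches 4 (State 0 (fun=> 0%N) g wm x) s' & prefix_inv 0 s'.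
Proof.
move=> g0; eexists.
  tick wm0; tick wm0; tick wm1; tick wm0; exact: reaches0.
split=> //=; first by rewrite /upd /=; split => //; lia.
  by rewrite g0 /psum big_geq.
move=> j; case: ltnP => // nj; rewrite x_out //; case: ifP => // jn.
by rewrite (_ : j - n = 0)%N /psum ?big_geq //; lia.
Qed.

Lemma prefix_inv_step k s : (k < n)%N -> prefix_inv k s ->
  exists2 s', reaches 7 s s' & prefix_inv k.+1 s'.
Proof.
case: s => pc w g wm' gm kn [/= -> [w1 w2 w3 w4 w5] g0 -> gmE].
pose e := (w1, w2, w4, w5, g0).
have gmk : gm k = x k by rewrite gmE kn.
eexists.
  tick e; tick e; tick e; tick e; tick e; tick e; tick e; exact: reaches0.
split=> //=; lookup; rewrite ?e; first by split=> //; lia.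
  by rewrite gmk /psum big_nat_recr.
move=> j; rewrite /upd gmk; case: eqP => [->|jk].
  rewrite ifN ?ifT; try lia.
  by rewrite (_ : (n.+1 + k - n = k.+1)%N) /psum ?big_nat_recr //; lia.
rewrite gmE; case: ifP => // jn; case: ifP; case: ifP => // *; lia.
Qed.

Lemma prefix_biclique_inv s : prefix_inv n s ->
  exists2 s', reaches 4 s s' & biclique_inv 0 s'.
Proof.
case: s => pc w g wm' gm [/= -> [w1 w2 w3 w4 w5] g0 -> gmE].
pose e := (w1, w2, w4, w5, g0).
eexists; first by tick e; tick e; tick e; tick e; exact: reaches0.
split=> //=.
  move=> j jn; rewrite gmE ifN ?ifT; try lia.
  by rewrite addKn.
(* The prefix sums end at address [n + n], so the difference array is still zero, the empty sum
   [diff 0]. *)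
move=> j; rewrite gmE !ifN; try lia.
by rewrite /diff big_geq.
Qed.

Lemma biclique_inv_step k s : (k < m)%N -> biclique_inv k s ->
  exists2 s', reaches 39 s s' & biclique_inv k.+1 s'.
Proof.
case: s => pc w g wm' gm km [/= -> [w1 w2 w3 w4 [w5 w6]] -> gmS gmD].
have [wm_p1 wm_p2 wm_q1 wm_q2] := wmB km.
have [p1n p2n q1n q2n] := ltB km.
(* The pointer [r6] advances by one; its successive values are put in the form used by [wmB]. *)
have e3 : (2 + 4 * k + 1 = 3 + 4 * k)%N by lia.
have e4 : (3 + 4 * k + 1 = 4 + 4 * k)%N by lia.
have e5 : (4 + 4 * k + 1 = 5 + 4 * k)%N by lia.
pose e := (w1, w2, w3, w4, w5, w6, (wm_p1, wm_p2, wm_q1, wm_q2), (e3, e4, e5)).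
have sp1 : gm (n + p1 k)%N = psum (p1 k) by apply: gmS; lia.
have sp2 : gm (n + (p2 k + 1))%N = psum (p2 k).+1 by rewrite addn1 gmS.
have sq1 : gm (n + q1 k)%N = psum (q1 k) by apply: gmS; lia.
have sq2 : gm (n + (q2 k + 1))%N = psum (q2 k).+1 by rewrite addn1 gmS.
eexists.
  do 39 tick e; exact: reaches0.
split=> //=.
- by lookup; rewrite ?e; split=> //; lia.
(* The four updates hit addresses from [(n + n).+1] on, beyond every prefix sum. *)
- move=> j jn; rewrite sp1 sp2 sq1 sq2 !upd_delta gmS // /delta !ifN ?addr0 //; lia.
move=> j; rewrite sp1 sp2 sq1 sq2 !upd_delta gmD !delta_shift !addn1 !deltaN.
by rewrite /diff big_nat_recr //= /biclique_diff !addrA.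
Qed.

Lemma biclique_output_inv s : biclique_inv m s ->
  exists2 s', reaches 4 s s' & output_inv 0 s'.
Proof.
case: s => pc w g wm' gm [/= -> [w1 w2 w3 w4 [w5 w6]] -> gmS gmD].
pose e := (w1, w2, w3, w4, w5, w6).
eexists; first by tick e; tick e; tick e; tick e; exact: reaches0.
split=> //=; lookup; first by rewrite ?e addn0.
by rewrite subrr big_geq.
Qed.

Lemma output_inv_step k s : (k < n)%N -> output_inv k s ->
  exists2 s', reaches 7 s s' & output_inv k.+1 s'.
Proof.
case: s => pc w g wm' gm kn [/= -> [w1 w2 w4 w5] g0 gmO gmD].
pose e := (w1, w2, w4, w5, g0, gmD).
eexists.
  do 7 tick e; exact: reaches0.
split=> //=; lookup; rewrite ?e.
- by split=> //; lia.
- by rewrite big_nat_recr.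
- move=> j jk; rewrite /upd; case: eqP => [->|jNk].
    by rewrite big_nat_recr.
  by apply: gmO; lia.
by move=> j; rewrite /upd ifN ?gmD //; lia.
Qed.

(** The loops cost [7 * n], [39 * m] and [7 * n]; the three runs leading to a loop cost 4 each and
    the final exit 2. *)
Lemma biclique_program_exec T : (14 * n + 39 * m + 14 <= T)%N ->
  exists2 s, exec W biclique_program T (State 0 (fun=> 0%N) (fun=> 0) wm x) = Some s
  & forall i, (i < n)%N -> gmem s i = \sum_(0 <= l < i.+1) diff m l.
Proof.
move=> leT.
have [s1 r1 /(reaches_loop prefix_inv_step) [s2 r2 inv2]] :=
  init_prefix_inv (erefl : (fun=> 0 : A) 0%N = 0).
have [s3 r3 /(reaches_loop biclique_inv_step) [s4 r4 inv4]] :=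
  prefix_biclique_inv inv2.
have [s5 r5 /(reaches_loop output_inv_step) [s6 r6]] := biclique_output_inv inv4.
have {}r6 := reaches_trans (reaches_trans r1 (reaches_trans r2 (reaches_trans r3
  (reaches_trans r4 r5)))) r6.
case: s6 r6 => pc w g wm' gm r6 [/= pcE [w1 w2 w4 w5] g0 gmO gmD].
rewrite {}pcE in r6.
pose e := (w1, w2, w4, w5).
(* The last loop exits to address 64, the length of the program, where the machine halts. *)
have [s7 r7 [pc7 gm7]] : exists2 s7, reaches 2 (State 56 w g wm' gm) s7 &
    Defs.pc s7 = 64%N /\ gmem s7 = gm.
  by eexists; first by tick e; tick e; exact: reaches0.
exists s7; last by rewrite gm7.
apply: (reaches_exec (reaches_trans r6 r7)); first by rewrite pc7.
lia.
Qed.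

(** After exchanging the sums, each point mass becomes a step function, and each pair of opposite
    steps the indicator of a side. *)
Lemma sum_diff i : (forall k, (k < m)%N -> (p1 k <= p2 k) && (q1 k <= q2 k))%N ->
  \sum_(0 <= l < i.+1) diff m l =
  \sum_(k < m)
    ((if (p1 k <= i <= p2 k)%N then psum (q2 k).+1 - psum (q1 k) else 0)
     + (if (q1 k <= i <= q2 k)%N then psum (p2 k).+1 - psum (p1 k) else 0)).
Proof.
move=> le12; rewrite /diff exchange_big /= big_mkord; apply: eq_bigr => k _.
have /andP[lep leq] := le12 k (ltn_ord k).
by rewrite big_split !sumrB /= !sum_delta !delta_itv.
Qed.

End Correctness.

(** * The adjacency product as a sum over bicliques *)

Section Adjacency.
Local Open Scope ring_scope.

Lemma set2_eq (T : finType) (u v x y : T) :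
  [set u; v] = [set x; y] -> (u = x /\ v = y) \/ (u = y /\ v = x).
Proof.
move=> /setP e; move: (e u) (e v) (e x) (e y); rewrite !inE !eqxx ?orbT /=.
case: (eqVneq u x) => [->|_] /= eu ev ex ey.
  left; split=> //; move: ev ey; rewrite ![y == _]eq_sym => /esym/orP[]/eqP-> //.
  by rewrite orbb => /eqP.
right; split; first by apply/eqP; rewrite -eu.
exact/esym/eqP.
Qed.

Variables (d : Order.disp_t) (V : finOrderType d).

Lemma mem_edge_set (G : sgraph V) u v : ([set u; v] \in edge_set G) = G u v.
Proof.
apply/imsetP/idP => [[[x y]]|Guv]; last by exists (u, v); rewrite ?inE.
rewrite inE /= => Gxy /set2_eq [] [-> ->] //.
by rewrite edge_sym.
Qed.

Lemma mem_biclique_edges (b : biclique V) u v :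
  ([set u; v] \in biclique_edges b) =
  (u \in itv (a1 b) (a2 b)) && (v \in itv (b1 b) (b2 b))
  || (v \in itv (a1 b) (a2 b)) && (u \in itv (b1 b) (b2 b)).
Proof.
apply/imset2P/orP => [[x y xA yB /set2_eq [] [-> ->]]|[]/andP[uA vB]].
- by left; rewrite xA yB.
- by right; rewrite xA yB.
- by exists u v.
- by exists v u; rewrite // setUC.
Qed.

Lemma leq_enum_rank (x y : V) :
  (Order.enum_rank x <= Order.enum_rank y)%N = (x <= y)%O.
Proof. exact: (Order.EnumVal.le_enum_rank le_total x y). Qed.

Lemma enum_val_itv (a c : V) (i : 'I_#|V|) :
  (Order.enum_val i \in itv a c) =
  (Order.enum_rank a <= i <= Order.enum_rank c)%N.
Proof.
by rewrite inE -!leq_enum_rank Order.EnumVal.enum_valK.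
Qed.

Variables (A : zmodType) (X : 'cV[A]_#|V|).

Lemma psum_itv (a c : nat) : (a <= c < #|V|)%N ->
  psum (nth 0 [seq X i 0 | i <- enum 'I_#|V|]) c.+1
    - psum (nth 0 [seq X i 0 | i <- enum 'I_#|V|]) a
  = \sum_(j < #|V| | (a <= j <= c)%N) X j 0.
Proof.
move=> /andP[ac cn]; rewrite /psum (@big_cat_nat _ _ _ a) //=; last exact: leqW.
rewrite [_ + _ - _]addrAC subrr add0r (@big_nat_widen _ _ _ _ _ #|V|) //.
rewrite big_geq_mkord; apply: eq_big => [j|j _]; first by rewrite andbC.
by rewrite (nth_map j) ?size_enum_ord // nth_ord_enum.
Qed.

(** Since the sides are disjoint, at most one of the two terms survives, and the neighbours of a
    vertex in the biclique form the opposite side. *)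
Lemma biclique_sum (b : biclique V) (i : 'I_#|V|) : biclique_ok b ->
  (if Order.enum_val i \in itv (a1 b) (a2 b) then
     \sum_(j | Order.enum_val j \in itv (b1 b) (b2 b)) X j 0 else 0)
  + (if Order.enum_val i \in itv (b1 b) (b2 b) then
     \sum_(j | Order.enum_val j \in itv (a1 b) (a2 b)) X j 0 else 0)
  = \sum_(j | [set Order.enum_val i; Order.enum_val j] \in biclique_edges b)
      X j 0.
Proof.
case/and3P=> _ _ disj; under [RHS]eq_bigl do rewrite mem_biclique_edges.
case: ifP => iA.
  rewrite (disjointFr disj iA) addr0.
  by apply: eq_bigl => j; rewrite andbF orbF.
rewrite add0r; case: ifP => iB.
  by apply: eq_bigl => j; rewrite andbT.
by rewrite big_pred0 // => j; rewrite andbF.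
Qed.

(** Once the sums are exchanged, [X j 0] is counted once per block containing the pair: once for an
    edge, by [pblock], and never otherwise. *)
Lemma adj_mul_partition (G : sgraph V) (B : seq (biclique V)) i :
  interval_biclique_partition G B ->
  adj_mul G X i 0 = \sum_(b <- B)
    \sum_(j | [set Order.enum_val i; Order.enum_val j] \in biclique_edges b)
      X j 0.
Proof.
move=> [_ uniqB /and3P[/eqP covB trivB _]].
rewrite mxE (exchange_big_dep predT) //= big_mkcond; apply: eq_bigr => j _.
rewrite mxE -mem_edge_set -covB.
set e := [set _; _]; set P := [set:: _] in covB trivB *.
(* Reindexed by the edge sets, distinct by [uniqB], the sum runs over the blocks that contain
   [e]. *)
rewrite -(big_map (@biclique_edges _ _) (fun E => e \in E) (fun=> X j 0)).
rewrite big_mkcond big_uniq //= -big_mkcondr /=.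
case: ifP => [eP|eNP].
  rewrite (big_pred1 (pblock P e)) // => E; apply/andP/eqP => [[EB eE]|->].
    by rewrite (def_pblock trivB _ eE) // inE.
  by rewrite mem_pblock eP; have := pblock_mem eP; rewrite inE.
rewrite big_pred0 // => E; apply/negP => /andP[EB eE].
by move/negP: eNP; apply; apply/bigcupP; exists E; rewrite ?inE.
Qed.

End Adjacency.

(** * Encoding of the input, and the time bound *)

Lemma nth_flatten_biclique_words (d : Order.disp_t) (V : finOrderType d)
    (b0 : biclique V) (B : seq (biclique V)) (k r : nat) :
  (k < size B) -> (r < 4) ->
  nth 0 (flatten [seq biclique_words b | b <- B]) (r + 4 * k) =
  nth 0 (biclique_words (nth b0 B k)) r.
Proof.
elim: B k => // b B IH [|k] kB r4.
  by rewrite muln0 addn0; case: r r4 {IH} => [|[|[|[|]]]].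
by rewrite (_ : r + 4 * k.+1 = (r + 4 * k).+4); [apply: IH | lia].
Qed.

Theorem theorem6p1 :
  exists (P : program) (c : nat),
    forall (A : zmodType) (d : Order.disp_t) (V : finOrderType d)
           (G : sgraph V) (B : seq (biclique V)) (X : 'cV[A]_#|V|),
      interval_biclique_partition G B ->
      let N := maxn 1 (#|V| + size B) in
      exists2 s : state A,
        exec (c * N) P (c * N) (input B X) = Some s
        & forall i : 'I_#|V|, gmem s i = adj_mul G X i 0%R.
Proof.
(* As [n + m <= N] and [1 <= N], the time [14 * n + 39 * m + 14] is at most [53 * N]; 70 leaves room
   and also bounds the words. *)
exists biclique_program, 70 => A d V G B X partB N.
(* [V] may be empty, leaving no default biclique, so the ranks are listed first and read with
   default 0. *)
pose rk (f : biclique V -> V) k :=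
  nth 0 [seq nat_of_ord (Order.enum_rank (f b)) | b <- B] k.
have rkE f b0 k : (k < size B) -> rk f k = Order.enum_rank (f (nth b0 B k)).
  by move=> kB; rewrite /rk (nth_map b0).
have rkT f (k : 'I_(size B)) : rk f k = Order.enum_rank (f (tnth (in_tuple B) k)).
  by rewrite (rkE _ (tnth (in_tuple B) k)) // -(tnth_nth _ (in_tuple B)).
set n := #|V| in N X *; set m := size B in N rkT rkE *.
pose wm := nth 0 [:: n, m & flatten [seq biclique_words b | b <- B]].
pose x := nth 0%R [seq X i 0%R | i <- enum 'I_n].
have W_gt_n : (3 * n + 3 < 70 * N) by lia.
have W_gt_m : (4 * m + 3 < 70 * N) by lia.
have wmB k : (k < m) ->
    [/\ wm (2 + 4 * k) = rk (@a1 _ _) k, wm (3 + 4 * k) = rk (@a2 _ _) k,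
        wm (4 + 4 * k) = rk (@b1 _ _) k & wm (5 + 4 * k) = rk (@b2 _ _) k].
  move=> kB; pose b0 := tnth (in_tuple B) (Ordinal kB).
  have wmE r : (r < 4) ->
      wm (r.+2 + 4 * k) = nth 0 (biclique_words (nth b0 B k)) r.
    by move=> r4; rewrite -nth_flatten_biclique_words.
  by rewrite !(rkE _ b0) // !wmE.
have ltB k : (k < m) ->
    [/\ rk (@a1 _ _) k < n, rk (@a2 _ _) k < n,
        rk (@b1 _ _) k < n & rk (@b2 _ _) k < n].
  move=> kB; pose b0 := tnth (in_tuple B) (Ordinal kB).
  by rewrite !(rkE _ b0) // !ltn_ord.
have x_out i : n <= i -> x i = 0%R.
  by move=> leni; rewrite /x nth_default // size_map size_enum_ord.
have time_ok : (14 * n + 39 * m + 14 <= 70 * N) by lia.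
have [s sE gmE] := biclique_program_exec W_gt_n W_gt_m erefl erefl wmB ltB x_out
  time_ok.
exists s => // i.
have okB (k : 'I_m) : biclique_ok (tnth (in_tuple B) k).
  by have [allB _ _] := partB; apply: (all_tnthP (t := in_tuple B) allB).
rewrite gmE // sum_diff => [|k kB]; last first.
  have /and3P[le_a le_b _] := okB (Ordinal kB).
  rewrite -[k]/(nat_of_ord (Ordinal kB)) !rkT.
  by rewrite !leq_enum_rank le_a le_b.
rewrite (adj_mul_partition _ _ partB) [RHS]big_tnth; apply: eq_bigr => k _.
have /and3P[le_a le_b _] := okB k.
rewrite -biclique_sum // !rkT !enum_val_itv !psum_itv ?ltn_ord ?andbT
  ?leq_enum_rank //.
by congr (_ + _)%R; case: ifP => // _; apply: eq_bigl => j; rewrite enum_val_itv.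
Qed.
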